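(* Let $\mathbf{K}$ be a quasivariety and $\langle\delta(x),\epsilon(x)\rangle$ an equation over its signature. Suppose that every inclusion $\sigma:Fm(Z)\hookrightarrow Fm(X)$ of free algebras coming from an inclusion of generators $Z\subseteq X$ induces a conservative extension of equational theories, i.e. that for every congruence $\theta\in Co_{\mathbf{K}}(Fm(X))$ we have $$Cn_{\mathbf{K}}^X\big(\{\langle\delta(\varphi),\epsilon(\varphi)\rangle\in\theta\mid\varphi\in Fm(X)\}\big)\cap Fm(Z)^2=Cn_{\mathbf{K}}^Z\big(\{\langle\delta(\varphi),\epsilon(\varphi)\rangle\in\theta\mid\varphi\in Fm(Z)\}\big).$$ Then the equational filter pair $(Co_{\mathbf{K}},i)$ associated to the equation $\langle\delta(x),\epsilon(x)\rangle$ satisfies: for every inclusion of sets $Z\subseteq X$ with induced inclusion $\sigma:Fm(Z)\hookrightarrow Fm(X)$ and every theory $T\subseteq Fm(X)$, $$(\sigma\times\sigma)^{-1}(\Xi_{Fm(X)}(T))=\Xi_{Fm(Z)}(\sigma^{-1}(T)).$$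
   Context: $Fm(X)$ is the absolutely free algebra (over the signature $\Sigma$ of $\mathbf{K}$) on a set $X$ of variables. A quasivariety is a class of algebras axiomatizable by quasi-identities. The equation is in at most one variable $x$. For a set $\Gamma\subseteq Fm(X)\times Fm(X)$, $Cn_{\mathbf{K}}^X(\Gamma)$ is the set of pairs $\langle\varphi,\psi\rangle\in Fm(X)^2$ such that for every $A\in\mathbf{K}$ and every homomorphism $h:Fm(X)\to A$ with $h(\eta)=h(\nu)$ for all $\langle\eta,\nu\rangle\in\Gamma$ one has $h(\varphi)=h(\psi)$ (equivalently, the $\mathbf{K}$-congruence on $Fm(X)$ generated by $\Gamma$). $Co_{\mathbf{K}}(A)$ is the lattice of congruences $\theta$ on $A$ with $A/\theta\in\mathbf{K}$, ordered by inclusion. The equational filter pair $(Co_{\mathbf{K}},i)$ associated to the equation is given by $i_A:Co_{\mathbf{K}}(A)\to\mathcal{P}(A)$, $i_A(\theta)=\{a\in A\mid\langle\delta^A(a),\epsilon^A(a)\rangle\in\theta\}$. $\Xi_A:\mathcal{P}(A)\to Co_{\mathbf{K}}(A)$ is the left adjoint of $i_A$: $\Xi_A(S)\subseteq\theta\iff S\subseteq i_A(\theta)$. A theory in $Fm(X)$ is a set in the image of $i_{Fm(X)}$ (equivalently, a filter on $Fm(X)$ of the associated logic). *)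

(* Defs.v *)
From mathcomp Require Import all_boot boolp classical_sets.

Set Implicit Arguments.
Unset Strict Implicit.
Unset Printing Implicit Defensive.

Local Open Scope classical_set_scope.

(** * Algebras over a finitary signature *)

Record signature : Type := Signature { symbol : Type; arity : symbol -> nat }.

(* Carriers may be empty, so that the free algebra on the empty set exists
   also over a signature without constants. *)
Record algebra (Sigma : signature) : Type := Algebra {
  carrier :> Type;
  op : forall f : symbol Sigma, ('I_(arity f) -> carrier) -> carrier }.

Definition is_hom (Sigma : signature) (A B : algebra Sigma) (h : A -> B) : Prop :=
  forall (f : symbol Sigma) (a : 'I_(arity f) -> A),
    h (op a) = op (fun i => h (a i)).

(** * Absolutely free algebras *)

Inductive term (Sigma : signature) (X : Type) : Type :=
| Var of X
| App (f : symbol Sigma) of ('I_(arity f) -> term Sigma X).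

Arguments Var {Sigma X} _.
Arguments App {Sigma X} f _.

Definition Fm (Sigma : signature) (X : Type) : algebra Sigma :=
  @Algebra Sigma (term Sigma X) (@App Sigma X).

Fixpoint eval (Sigma : signature) (X : Type) (A : algebra Sigma) (v : X -> A)
    (t : term Sigma X) : A :=
  match t with
  | Var x => v x
  | App f ts => op (fun i => eval v (ts i))
  end.

Definition Fm_incl (Sigma : signature) (X : Type) (Z : set X) :
    Fm Sigma Z -> Fm Sigma X :=
  @eval Sigma Z (Fm Sigma X) (fun z => Var (val z)).

Definition map_pair (A B : Type) (h : A -> B) (p : A * A) : B * B :=
  (h p.1, h p.2).

(** * Quasivarieties *)

Record quasi_identity (Sigma : signature) : Type := QuasiIdentity {
  num_premises : nat;
  premise : 'I_num_premises -> Fm Sigma nat * Fm Sigma nat;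
  conclusion : Fm Sigma nat * Fm Sigma nat }.

Definition satisfies (Sigma : signature) (A : algebra Sigma)
    (q : quasi_identity Sigma) : Prop :=
  forall v : nat -> A,
    (forall i : 'I_(num_premises q),
       eval v (premise i).1 = eval v (premise i).2) ->
    eval v (conclusion q).1 = eval v (conclusion q).2.

Definition is_quasivariety (Sigma : signature) (K : algebra Sigma -> Prop) : Prop :=
  exists Q : set (quasi_identity Sigma),
    forall A : algebra Sigma, K A <-> forall q, Q q -> satisfies A q.

(** * Congruences and quotients *)

Record congruence (Sigma : signature) (A : algebra Sigma) : Type := Congruence {
  cong_set :> set (A * A);
  cong_refl : forall a, cong_set (a, a);
  cong_sym : forall a b, cong_set (a, b) -> cong_set (b, a);
  cong_trans : forall a b c,
    cong_set (a, b) -> cong_set (b, c) -> cong_set (a, c);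
  cong_op : forall (f : symbol Sigma) (a b : 'I_(arity f) -> A),
    (forall i, cong_set (a i, b i)) -> cong_set (op a, op b) }.

Definition quot_carrier (Sigma : signature) (A : algebra Sigma)
    (theta : congruence A) : Type :=
  {C : set A | exists a, C = [set b | cong_set theta (a, b)]}.

Definition class (Sigma : signature) (A : algebra Sigma) (theta : congruence A)
    (a : A) : quot_carrier theta :=
  exist _ [set b | cong_set theta (a, b)] (ex_intro _ a erefl).

Definition repr (Sigma : signature) (A : algebra Sigma) (theta : congruence A)
    (C : quot_carrier theta) : A :=
  sval (cid (svalP C)).

(* The operations are computed on chosen representatives; [class_hom] below
   says that the result does not depend on them. *)
Definition quotient (Sigma : signature) (A : algebra Sigma)
    (theta : congruence A) : algebra Sigma :=
  @Algebra Sigma (quot_carrier theta)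
    (fun f C => class theta (op (fun i => repr (C i)))).

Lemma class_eqP (Sigma : signature) (A : algebra Sigma) (theta : congruence A)
    (a b : A) : class theta a = class theta b <-> cong_set theta (a, b).
Proof.
split=> [/(congr1 sval)/= /(congr1 (fun C : set A => C b))/= ->|ab].
  exact: cong_refl.
apply: eq_exist => /=; apply/seteqP; split=> c /= ?.
  exact: cong_trans (cong_sym ab) _.
exact: cong_trans ab _.
Qed.

Lemma reprK (Sigma : signature) (A : algebra Sigma) (theta : congruence A) :
  cancel (@repr Sigma A theta) (class theta).
Proof.
by case=> C HC; apply: eq_exist; rewrite /repr; case: cid => a /= ->.
Qed.

Lemma class_hom (Sigma : signature) (A : algebra Sigma) (theta : congruence A) :
  @is_hom Sigma A (quotient theta) (class theta).
Proof.
by move=> f a; apply/class_eqP/cong_op => i; apply/class_eqP; rewrite reprK.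
Qed.

Lemma hom_eval (Sigma : signature) (X : Type) (A B : algebra Sigma)
    (h : A -> B) (v : X -> A) (t : term Sigma X) :
  is_hom h -> h (eval v t) = eval (fun x => h (v x)) t.
Proof.
move=> hh; elim: t => //= f ts IH; rewrite hh; congr op.
exact/funext.
Qed.

Lemma satisfies_quotient (Sigma : signature) (A : algebra Sigma)
    (theta : congruence A) (q : quasi_identity Sigma) :
  satisfies (quotient theta) q <->
  forall v : nat -> A,
    (forall i : 'I_(num_premises q),
       cong_set theta (eval v (premise i).1, eval v (premise i).2)) ->
    cong_set theta (eval v (conclusion q).1, eval v (conclusion q).2).
Proof.
have evE (v : nat -> A) (t : Fm Sigma nat) :
    @eval _ _ (quotient theta) (fun n => class theta (v n)) t
    = class theta (eval v t).
  by rewrite (hom_eval v t (@class_hom _ _ theta)).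
split=> H v prem.
  apply/class_eqP; rewrite -!evE; apply: H.
  by move=> i; rewrite !evE; apply/class_eqP/prem.
have vE : v = (fun n => class theta (repr (v n))).
  by apply/funext => n; rewrite reprK.
rewrite vE !evE; apply/class_eqP/H => i; apply/class_eqP.
by rewrite -!evE -vE.
Qed.

(** * Relative congruences and relative equational consequence *)

Record Co (Sigma : signature) (K : algebra Sigma -> Prop) (A : algebra Sigma) :
    Type := RelCongruence {
  Co_cong :> congruence A;
  Co_in : K (quotient Co_cong) }.

Definition Cn (Sigma : signature) (K : algebra Sigma -> Prop) (X : Type)
    (Gamma : set (Fm Sigma X * Fm Sigma X)) : set (Fm Sigma X * Fm Sigma X) :=
  [set p | forall A : algebra Sigma, K A ->
           forall h : Fm Sigma X -> A, is_hom h ->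
           (forall e, Gamma e -> h e.1 = h e.2) -> h p.1 = h p.2].

(** * The equational filter pair *)

(* An equation in at most one variable is a pair of elements of [Fm Sigma unit],
   and [inst delta epsilon a] is the pair of its values at [a]. *)
Definition inst (Sigma : signature) (delta epsilon : Fm Sigma unit)
    (A : algebra Sigma) (a : A) : A * A :=
  (eval (fun=> a) delta, eval (fun=> a) epsilon).

Definition solution_set (Sigma : signature) (K : algebra Sigma -> Prop)
    (delta epsilon : Fm Sigma unit) (A : algebra Sigma) (theta : Co K A) : set A :=
  [set a | cong_set theta (inst delta epsilon a)].

Definition is_theory (Sigma : signature) (K : algebra Sigma -> Prop)
    (delta epsilon : Fm Sigma unit) (X : Type) (T : set (Fm Sigma X)) : Prop :=
  range (@solution_set Sigma K delta epsilon (Fm Sigma X)) T.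

Lemma left_adjoint_exists (Sigma : signature) (K : algebra Sigma -> Prop)
    (delta epsilon : Fm Sigma unit) (A : algebra Sigma) :
  is_quasivariety K ->
  exists Xi : set A -> Co K A, forall (S : set A) (theta : Co K A),
    Xi S `<=` theta <-> S `<=` solution_set delta epsilon theta.
Proof.
move=> KQ; suff H (S : set A) : exists xi : Co K A, forall theta : Co K A,
    xi `<=` theta <-> S `<=` solution_set delta epsilon theta.
  by exists (fun S => sval (cid (H S))) => S; exact: (svalP (cid (H S))).
pose F := [set theta : Co K A | S `<=` solution_set delta epsilon theta].
pose I := \bigcap_(theta in F) (theta : set (A * A)).
have Ir a : I (a, a) by move=> theta _; exact: cong_refl.
have Is a b : I (a, b) -> I (b, a).
  by move=> ab theta Ft; apply/cong_sym/ab.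
have It a b c : I (a, b) -> I (b, c) -> I (a, c).
  by move=> ab bc theta Ft; apply: cong_trans (ab _ Ft) (bc _ Ft).
have Io (f : symbol Sigma) (a b : 'I_(arity f) -> A) :
    (forall i, I (a i, b i)) -> I (op a, op b).
  by move=> ab theta Ft; apply: cong_op => i; exact: ab.
pose xi := Congruence Ir Is It Io.
have Kxi : K (quotient xi).
  have [Q KE] := KQ; apply/KE => q Qq; apply/satisfies_quotient => v prem.
  move=> theta Ft.
  have := Co_in theta; move=> /KE /(_ q Qq)/satisfies_quotient; apply.
  by move=> i; exact: prem.
exists (RelCongruence Kxi) => theta; split=> [le a Sa|St p]; last exact.
by apply: le => theta' Ft; exact: Ft.
Qed.

(* The adjunction determines the set of pairs underlying [Xi S] uniquely. *)
Definition Xi (Sigma : signature) (K : algebra Sigma -> Prop)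
    (KQ : is_quasivariety K) (delta epsilon : Fm Sigma unit)
    (A : algebra Sigma) : set A -> Co K A :=
  sval (cid (left_adjoint_exists delta epsilon A KQ)).

Lemma Xi_adjoint (Sigma : signature) (K : algebra Sigma -> Prop)
    (KQ : is_quasivariety K) (delta epsilon : Fm Sigma unit)
    (A : algebra Sigma) (S : set A) (theta : Co K A) :
  Xi KQ delta epsilon S `<=` theta <-> S `<=` solution_set delta epsilon theta.
Proof. exact: (svalP (cid (left_adjoint_exists delta epsilon A KQ))). Qed.

(* Main.v *)
(* The congruence [Xi S] is generated, relative to [K], by the instances of the
   equation at the elements of [S]; on a free algebra it is therefore
   [Cn K (inst @` S)].  For the theory of the solutions of [theta], the instances at
   its elements are exactly the instances lying in [theta], so both sides of the
   conclusion turn into those of the conservativity hypothesis for [theta]. *)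
Require Import Defs.
From mathcomp Require Import all_boot boolp classical_sets.

Set Implicit Arguments.
Unset Strict Implicit.
Unset Printing Implicit Defensive.

Local Open Scope classical_set_scope.

Definition hom_kernel (Sigma : signature) (A B : algebra Sigma) (h : A -> B)
    (hh : is_hom h) : congruence A.
Proof.
refine (@Congruence Sigma A [set p | h p.1 = h p.2] _ _ _ _) => /=.
- by [].
- by move=> a b ->.
- by move=> a b c -> ->.
- by move=> f a b ab; rewrite !hh; congr op; apply/funext.
Defined.

(** The quotient embeds into [B], and quasi-identities pass to subalgebras; [h] carries premises and
    conclusion over directly. *)
Lemma quasivariety_hom_kernel (Sigma : signature) (K : algebra Sigma -> Prop)
    (A B : algebra Sigma) (h : A -> B) (hh : is_hom h) :
  is_quasivariety K -> K B -> K (quotient (hom_kernel hh)).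
Proof.
move=> [Q KE] /KE KB; apply/KE => q Qq; apply/satisfies_quotient => v /= prem.
rewrite !(hom_eval _ _ hh); apply: (KB q Qq) => i.
by rewrite -!(hom_eval _ _ hh).
Qed.

Lemma hom_inst (Sigma : signature) (delta epsilon : Fm Sigma unit)
    (A B : algebra Sigma) (h : A -> B) (a : A) :
  is_hom h -> map_pair h (inst delta epsilon a) = inst delta epsilon (h a).
Proof. by move=> hh; rewrite /map_pair /= !(hom_eval _ _ hh). Qed.

(** Kernels of homomorphisms into [K] are relative congruences; conversely, [Cn] is tested on the
    quotient map of [Xi S]. *)
Lemma Xi_Cn (Sigma : signature) (K : algebra Sigma -> Prop)
    (KQ : is_quasivariety K) (delta epsilon : Fm Sigma unit) (X : Type)
    (S : set (Fm Sigma X)) :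
  Xi KQ delta epsilon S
  = Cn K (@inst Sigma delta epsilon (Fm Sigma X) @` S) :> set _.
Proof.
apply/seteqP; split=> [p Xip A KA h hh hS|[a b] Cnab].
  pose ker := RelCongruence (quasivariety_hom_kernel hh KQ KA).
  suff /Xi_adjoint le : S `<=` solution_set delta epsilon ker by exact: le Xip.
  by move=> a Sa; apply: (hS (inst delta epsilon a)); exists a.
(* The unit of the adjunction. *)
have /Xi_adjoint SXi := @subset_refl _ (Xi KQ delta epsilon S : set _).
apply/class_eqP/(Cnab _ (Co_in _) _ (@class_hom _ _ _)) => _ [c Sc <-].
exact/class_eqP/SXi.
Qed.

(** [R] is any set of pairs, so that the preimage of [theta] on [Fm Sigma Z] is covered without
    making it a congruence. *)
Lemma inst_solution_set (Sigma : signature) (delta epsilon : Fm Sigma unit)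
    (A : algebra Sigma) (R : set (A * A)) :
  @inst Sigma delta epsilon A @` [set a | R (inst delta epsilon a)]
  = range (@inst Sigma delta epsilon A) `&` R.
Proof.
apply/seteqP; split=> [_ [a Ra <-]|_ [[a _ <-] Ra]]; last by exists a.
by split=> //; exists a.
Qed.

Theorem lemma5p10 (Sigma : signature) (K : algebra Sigma -> Prop)
    (KQ : is_quasivariety K) (delta epsilon : Fm Sigma unit) :
  (forall (X : Type) (Z : set X) (theta : Co K (Fm Sigma X)),
     map_pair (@Fm_incl Sigma X Z) @^-1`
       Cn K (range (@inst Sigma delta epsilon (Fm Sigma X)) `&` theta)
     = Cn K (range (@inst Sigma delta epsilon (Fm Sigma Z)) `&`
             map_pair (@Fm_incl Sigma X Z) @^-1` theta)) ->
  forall (X : Type) (Z : set X) (T : set (Fm Sigma X)),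
    is_theory K delta epsilon T ->
    map_pair (@Fm_incl Sigma X Z) @^-1` Xi KQ delta epsilon T
    = Xi KQ delta epsilon (@Fm_incl Sigma X Z @^-1` T).
Proof.
move=> conservative X Z _ [theta _ <-].
have incl_hom : is_hom (@Fm_incl Sigma X Z) by [].
rewrite !Xi_Cn inst_solution_set conservative -inst_solution_set.
congr (Cn K (_ @` _)); apply/funext => a.
(* Solving the preimage of [theta] at [a] is solving [theta] at the image of [a]. *)
by rewrite /preimage /solution_set /mkset (hom_inst _ _ _ incl_hom).
Qed.
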